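(* Let $0<\alpha<1$ and let $\{J_{ij}\}_{1\le i<j\le N}$ be i.i.d. non-negative heavy-tailed couplings, i.e. $\mathbb P(J_{ij}\ge x)=x^{-\alpha}L(x)$ with $L$ slowly varying (the common law not depending on $N$). Then, with probability tending to $1$ as $N\to\infty$, the Hamiltonian $H$ has at least one (non-trivial) local minimum on the hypercube $\{\pm1\}^N$. Moreover, there exists $\epsilon>0$, not depending on $N$, such that the zero-temperature dynamics of the corresponding disordered Curie–Weiss model satisfies $$\epsilon<q_D(N)<1-\epsilon$$ for all sufficiently large $N$.
   Context: Slowly varying means $\lim_{x\to\infty}L(ax)/L(x)=1$ for every $a>0$. Model. Put $J_{ji}=J_{ij}$; the Hamiltonian is $H(\sigma)=-\frac1N\sum_{1\le i<j\le N}J_{ij}\sigma_i\sigma_j$, $\sigma\in\{\pm1\}^N$ (a positive constant factor, as from summing over ordered pairs, is immaterial). The law of the couplings is $\mathbb P_{\mathcal J}$. Local minimum. A state $\sigma\in\{\pm1\}^N$ is a (non-trivial) local minimum of $H$ if $\sigma\ne\pm(1,\dots,1)$ and $H(\sigma')\ge H(\sigma)$ for every $\sigma'\in\{\pm1\}^N$ at Hamming distance $1$ from $\sigma$. Zero-temperature dynamics. Given the couplings, this is the discrete-time Markov chain $\sigma(t)=(\sigma_1(t),\dots,\sigma_N(t))$ on $\{\pm1\}^N$ with $P(\sigma,\sigma^{(i)})=\frac1N\big[\mathbf 1\{H(\sigma^{(i)})<H(\sigma)\}+\frac12\mathbf 1\{H(\sigma^{(i)})=H(\sigma)\}\big]$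 for each $i$, where $\sigma^{(i)}$ is $\sigma$ with spin $i$ flipped, and otherwise staying put. $\mathbb E_\omega$ is expectation over the evolution of the chain given couplings and initial state. Order parameter. $\sigma(0)$ is uniform on $\{\pm1\}^N$ (i.i.d. symmetric $\pm1$ spins), independent of the couplings, and $$q_D(N)=\mathbb E_{\sigma(0),\mathcal J}\big[(\mathbb E_\omega[\sigma_1(\infty)])^2\big],\qquad \sigma_1(\infty)=\lim_{t\to\infty}\sigma_1(t),$$ with the convention $\sigma_1(\infty)=0$ if the limit does not exist. *)

(* Defs.v *)
From HB Require Import structures.
From mathcomp Require Import all_boot all_order all_algebra.
From mathcomp Require Import all_classical all_reals all_analysis.

Set Implicit Arguments.
Unset Strict Implicit.
Unset Printing Implicit Defensive.

Import Order.TTheory GRing.Theory Num.Theory.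
Import numFieldNormedType.Exports.

Local Open Scope classical_set_scope.
Local Open Scope ring_scope.

Definition slowly_varying (R : realType) (L : R -> R) : Prop :=
  forall a : R, 0 < a -> L (a * x) / L x @[x --> +oo] --> (1 : R).

Definition mutually_independent (R : realType) (d : measure_display)
    (T : measurableType d) (P : probability T R) (I : finType)
    (X : I -> {RV P >-> R}) : Prop :=
  forall (S : {set I}) (A : I -> set R), (forall i, measurable (A i)) ->
    P (\bigcap_(i in [set` S]) X i @^-1` A i) =
    (\prod_(i in S) P (X i @^-1` A i))%E.

Definition iid (R : realType) (d : measure_display)
    (T : measurableType d) (P : probability T R) (I : finType)
    (X : I -> {RV P >-> R}) (mu : probability (measurableTypeR R) R) : Prop :=
  (forall (i : I) (A : set R), measurable A -> distribution P (X i) A = mu A) /\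
  mutually_independent X.

Definition edge (n : nat) : finType :=
  {p : 'I_n * 'I_n | (p.1 < p.2)%N}.

Definition couplings (R : realType) (n : nat) : Type := edge n -> R.

(* true encodes the spin +1, false the spin -1. *)
Definition state (n : nat) : finType := {ffun 'I_n -> bool}.

Definition spin (R : realType) (n : nat) (s : state n) (i : 'I_n) : R :=
  if s i then 1 else -1.

Definition hamiltonian (R : realType) (n : nat) (j : couplings R n)
    (s : state n) : R :=
  - (n%:R^-1 *
     \sum_(e : edge n) j e * spin R s (val e).1 * spin R s (val e).2).

Definition hamming (n : nat) (s s' : state n) : nat :=
  #|[set i | s i != s' i]%SET|.

Definition local_minimum (R : realType) (n : nat) (j : couplings R n)
    (s : state n) : Prop :=
  [/\ s <> [ffun=> true], s <> [ffun=> false] &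
      forall s' : state n, hamming s s' = 1%N ->
        hamiltonian j s <= hamiltonian j s'].

Definition flip (n : nat) (i : 'I_n) (s : state n) : state n :=
  [ffun k => if k == i then ~~ s k else s k].

Definition flip_prob (R : realType) (n : nat) (j : couplings R n)
    (s : state n) (i : 'I_n) : R :=
  n%:R^-1 * ((hamiltonian j (flip i s) < hamiltonian j s)%R%:R +
             2^-1 * (hamiltonian j (flip i s) == hamiltonian j s)%R%:R).

Definition transition (R : realType) (n : nat) (j : couplings R n)
    (s s' : state n) : R :=
  if s' == s then 1 - \sum_(i < n) flip_prob j s i
  else \sum_(i < n | flip i s == s') flip_prob j s i.

(* The last clause is the Markov property with transition matrix K, with the
   conditional probability multiplied out so that it also covers histories of
   probability zero. *)
Definition markov_chain (R : realType) (d : measure_display)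
    (T : measurableType d) (Q : probability T R) (S : finType)
    (K : S -> S -> R) (s0 : S) (X : nat -> T -> S) : Prop :=
  [/\ forall (t : nat) (s : S), measurable [set w | X t w = s],
      Q [set w | X 0%N w = s0] = 1%E &
      forall (t : nat) (x : nat -> S),
        Q [set w | forall k, (k <= t.+1)%N -> X k w = x k] =
        (Q [set w | forall k, (k <= t)%N -> X k w = x k] *
         (K (x t) (x t.+1))%:E)%E].

(* A realization, on some probability space, of the zero-temperature dynamics
   with couplings j and initial state s0; these data determine the law of the
   trajectory. *)
Record zero_temp_dynamics (R : realType) (n : nat) (j : couplings R n)
    (s0 : state n) := ZeroTempDynamics {
  dyn_display : measure_display;
  dyn_space : measurableType dyn_display;
  dyn_law : probability dyn_space R;
  dyn_path : nat -> dyn_space -> state n;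
  dyn_markov : markov_chain dyn_law (transition j) s0 dyn_path }.
Arguments dyn_path {R n j s0} _ _ _.

Definition spin_infty (R : realType) (n : nat) (i : 'I_n)
    (x : nat -> state n) : R :=
  let u : nat -> R := fun t => spin R (x t) i in
  if `[< cvgn u >] then limn u else 0.

Definition mean_spin_infty (R : realType) (n : nat) (i : 'I_n)
    (j : couplings R n) (s0 : state n) (Z : zero_temp_dynamics j s0) : R :=
  fine ('E_(dyn_law Z)[fun w => spin_infty R i (fun t => dyn_path Z t w)])%E.

Definition uniform_state (R : realType) (d : measure_display)
    (T : measurableType d) (P : probability T R) (n : nat)
    (s0 : T -> state n) : Prop :=
  forall s : state n, measurable [set w | s0 w = s] /\
    P [set w | s0 w = s] = ((2 ^+ n)^-1)%:E.

Definition independent_of_couplings (R : realType) (d : measure_display)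
    (T : measurableType d) (P : probability T R) (n : nat)
    (J : edge n -> {RV P >-> R}) (s0 : T -> state n) : Prop :=
  forall (s : state n) (A : set T),
    <<s [set J e @^-1` B | e in [set: edge n] & B in measurable] >> A ->
    P (A `&` [set w | s0 w = s]) = (P A * P [set w | s0 w = s])%E.

(* The number of spins is n.+1; the first spin sits at the site ord0. *)
Definition qD (R : realType) (d : measure_display) (T : measurableType d)
    (P : probability T R) (n : nat) (J : edge n.+1 -> {RV P >-> R})
    (s0 : T -> state n.+1)
    (Z : forall (j : couplings R n.+1) (s : state n.+1),
       zero_temp_dynamics j s) : \bar R :=
  ('E_P[fun w => (mean_spin_infty ord0 (Z (fun e => J e w) (s0 w)) ^+ 2)%R])%E.

(* Main.v *)
Require Import Defs.
From HB Require Import structures.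
From mathcomp Require Import all_boot all_order all_algebra.
From mathcomp Require Import all_classical all_reals all_analysis.
From mathcomp Require Import measurable_realfun.
From mathcomp Require Import ring lra zify.

Set Implicit Arguments.
Unset Strict Implicit.
Unset Printing Implicit Defensive.

Import Order.TTheory GRing.Theory Num.Theory.
Import numFieldNormedType.Exports.

Local Open Scope classical_set_scope.
Local Open Scope ring_scope.

(** Why the theorem is true.

    Call an edge good at level [y] if its coupling is at least [y] while, at
    each of its two endpoints, the absolute values of all the other couplings
    add up to less than [y].  The sign of the local field at an endpoint is then
    decided by the edge alone: aligned endpoints never flip, and when the
    endpoints disagree a flip of either one lowers the energy.

    Existence of good edges.  Since [alpha < 1], the mean of a coupling capped at
    [y] is at most [C * y * F y], where [F] is the tail of the common law
    ([cap_mean_tail]); this is where regular variation enters, and only along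
    powers of two.  By Markov's inequality an edge is large (at least [y]) but
    not good with probability at most [C' * n * F y ^ 2] ([prob_not_good]),
    against [F y] for being large.

    Local minima.  Take [F y] of order [K / n ^ 2].  A set of order [n ^ 2] edges
    contains a large edge with probability at least [1 - O(1 / K)], and the
    expected number of large edges which are not good is [O(K ^ 2 / n)].  Hence
    with probability close to 1 there are two distinct good edges.  They are
    disjoint ([good_edge_disjoint]), and minimising the energy with one of them
    held at +1 and the other at -1 produces a local minimum other than the two
    constant states ([good_edges_local_minimum]).

    Overlap.  Take [F y] of order [1 / n].  With probability bounded below, some
    edge at the first site, say to the site [b], is good.  Along a good edge
    [a b] the sum of the two spins is a martingale and their disagreement decays
    geometrically, so the mean of the limit of the first spin is the average of
    the two initial spins ([mean_spin_good_edge]).  Its square is 1 if they agree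
    and 0 if they do not; as the initial state is uniform and independent of the
    couplings, both cases have probability 1/2, which bounds the overlap away
    from 0 and from 1 ([qD_bounds]). *)

(** * Real-valued probabilities *)

Definition prob (R : realType) (d : measure_display) (T : measurableType d)
    (P : probability T R) (A : set T) : R := fine (P A).

Lemma probE (R : realType) (d : measure_display) (T : measurableType d)
    (P : probability T R) (A : set T) : measurable A -> P A = (prob P A)%:E.
Proof. by move=> mA; rewrite /prob fineK// fin_num_measure. Qed.

Lemma prob_ge0 (R : realType) (d : measure_display) (T : measurableType d)
    (P : probability T R) (A : set T) : 0 <= prob P A.
Proof. by rewrite /prob fine_ge0. Qed.

Lemma prob_le1 (R : realType) (d : measure_display) (T : measurableType d)
    (P : probability T R) (A : set T) : measurable A -> prob P A <= 1.
Proof. by move=> mA; rewrite -lee_fin -probE// probability_le1. Qed.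

Lemma le_prob (R : realType) (d : measure_display) (T : measurableType d)
    (P : probability T R) (A B : set T) :
  measurable A -> measurable B -> A `<=` B -> prob P A <= prob P B.
Proof. by move=> mA mB AB; rewrite -lee_fin -!probE// le_measure ?inE. Qed.

Lemma probU (R : realType) (d : measure_display) (T : measurableType d)
    (P : probability T R) (A B : set T) :
  measurable A -> measurable B -> A `&` B = set0 ->
  prob P (A `|` B) = prob P A + prob P B.
Proof.
move=> mA mB AB; apply: EFin_inj; rewrite EFinD -!probE//.
  by rewrite measureU.
exact: measurableU.
Qed.

Lemma prob_le_add (R : realType) (d : measure_display) (T : measurableType d)
    (P : probability T R) (A B C : set T) :
  measurable A -> measurable B -> measurable C -> A `<=` B `|` C ->
  prob P A <= prob P B + prob P C.
Proof.
move=> mA mB mC ABC; rewrite -lee_fin EFinD -!probE//.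
apply: (@le_trans _ _ (P (B `|` C))).
  by rewrite le_measure ?inE//; exact: measurableU.
exact: measureU2.
Qed.

Lemma prob_bigU_le (R : realType) (d : measure_display) (T : measurableType d)
    (P : probability T R) (I : Type) (r : seq I) (p : pred I)
    (A : I -> set T) : (forall i, measurable (A i)) ->
  prob P (\big[setU/set0]_(i <- r | p i) A i) <= \sum_(i <- r | p i) prob P (A i).
Proof.
move=> mA; have mU s : measurable (\big[setU/set0]_(i <- s | p i) A i).
  by apply: bigsetU_measurable.
elim: r => [|x r IH]; first by rewrite !big_nil /prob measure0.
rewrite !big_cons; case: ifP => // px.
by apply: (le_trans (prob_le_add P _ (mA x) (mU r) (@subset_refl _ _)));
  [exact: measurableU|rewrite lerD2l].
Qed.

Lemma measurable_fin_fun_in (d : measure_display) (T : measurableType d)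
    (F : finType) (Y : T -> F) (B : pred F) :
  (forall y, measurable [set w | Y w = y]) -> measurable [set w | B (Y w)].
Proof.
move=> mY; rewrite (_ : [set w | _] = \bigcup_(y in [set y | B y]) [set w | Y w = y]).
  by apply: fin_bigcup_measurable => //; exact: finite_finset.
by apply/seteqP; split => [w Bw|w [y By] /= ->//]; exists (Y w).
Qed.

Lemma prob_partition (R : realType) (d : measure_display)
    (T : measurableType d) (P : probability T R) (F : finType) (Y : T -> F)
    (A : set T) : measurable A -> (forall y, measurable [set w | Y w = y]) ->
  prob P A = \sum_y prob P (A `&` [set w | Y w = y]).
Proof.
move=> mA mY.
have H (r : seq F) : uniq r ->
    prob P (A `&` [set w | Y w \in r]) =
    \sum_(y <- r) prob P (A `&` [set w | Y w = y]).
  elim: r => [_|x r IH /= /andP[xr ur]].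
    rewrite big_nil (_ : _ `&` _ = set0) ?/prob ?measure0//.
    by apply/seteqP; split => // w [].
  rewrite big_cons -IH// -probU.
  - congr (prob P _); apply/seteqP; split => w /=.
      by move=> [Aw]; rewrite inE => /orP[/eqP|]; [left|right].
    by move=> [[Aw ->]|[Aw wr]]; rewrite inE ?eqxx ?wr ?orbT.
  - exact: measurableI.
  - by apply: measurableI => //; exact: (@measurable_fin_fun_in _ _ _ Y (fun y => y \in r)).
  - by apply/seteqP; split => // w [[_ /= ->] []]; rewrite (negbTE xr).
rewrite -big_enum -(H _ (enum_uniq _)); congr (prob P _).
by apply/seteqP; split => [w Aw|w []]//; split => //=; rewrite mem_enum.
Qed.

Lemma prob_setC (R : realType) (d : measure_display) (T : measurableType d)
    (P : probability T R) (A : set T) :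
  measurable A -> prob P (~` A) = 1 - prob P A.
Proof.
move=> mA; apply: EFin_inj; rewrite EFinB -!probE//.
  exact: probability_setC.
exact: measurableC.
Qed.

(** * Heavy tails *)

Section heavy_tail.
Context (R : realType) (alpha : R) (halpha1 : alpha < 1)
  (L : R -> R) (hL : slowly_varying L)
  (mu : probability (measurableTypeR R) R)
  (mu_tail : forall x : R, 0 < x ->
     mu [set y : R | x <= y] = (x `^ (- alpha) * L x)%:E).

Definition tail (y : R) : R := prob mu [set x : R | y <= x].

Lemma measurable_ge (y : R) :
  measurable ([set x : R | y <= x] : set (measurableTypeR R)).
Proof.
rewrite (_ : [set x | _] = [set` `[y, +oo[]); first exact: measurable_itv.
by apply/seteqP; split => x /=; rewrite in_itv/= andbT.
Qed.

(** Doubling the threshold multiplies the tail by about [2 `^ (- alpha)], and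
    [2 `^ (- alpha) > 1 / 2] is where [alpha < 1] enters. *)
Lemma tail_ratio : exists (r : R) (k0 : nat), 2^-1 < r /\
  forall k : nat, (k0 <= k)%N ->
  0 < tail (2 ^+ k) /\ r * tail (2 ^+ k) <= tail (2 ^+ k.+1).
Proof.
pose c : R := 2 `^ (- alpha).
have c0 : 0 < c by rewrite powR_gt0.
have chalf : 2^-1 < c.
  rewrite -(powR_inv1 (ler0n R 2)) /c /powR !pnatr_eq0/= ltr_expR.
  by rewrite ltr_pM2r ?ln_gt0 ?ltr1n// ltrN2.
pose r := (2^-1 + c) / 2.
have rhalf : 2^-1 < r by rewrite /r; lra.
have rc : r < c by rewrite /r; lra.
have : \forall x \near +oo, r / c < L (2 * x) / L x.
  by apply: cvgr_gt (hL (ltr0n R 2)) _ _; rewrite ltr_pdivrMr// mul1r.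
move=> [M [_ hM]]; pose k0 := Num.bound `|M|.
exists r, k0; split=> //.
move=> k k0k; have : M < 2 ^+ k.
  apply: (le_lt_trans (ler_norm M)).
  apply: (lt_le_trans (archi_boundP (normr_ge0 M))).
  rewrite -natrX ler_nat (leq_trans k0k)// ltnW//; exact: ltn_expl.
move/hM => /= hk; have p2 (m : nat) : 0 < 2 ^+ m :> R by rewrite exprn_gt0.
have tE m : tail (2 ^+ m) = (2 ^+ m) `^ (- alpha) * L (2 ^+ m).
  by rewrite /tail /prob mu_tail.
have L0 m : 0 <= L (2 ^+ m).
  by rewrite -(pmulr_rge0 _ (powR_gt0 (- alpha) (p2 m))) -tE prob_ge0.
(* If [L] vanished here, the ratio would be 0 by the convention on inverses. *)
have Lk : 0 < L (2 ^+ k).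
  rewrite lt_def L0 andbT; apply: contraTneq hk => ->.
  by rewrite invr0 mulr0 -leNgt divr_ge0// ltW// (lt_trans _ rhalf).
rewrite !tE; split; first by rewrite mulr_gt0 ?powR_gt0.
rewrite exprS powRM ?(ltW (p2 _))// -/c mulrCA -mulrA [leRHS]mulrCA.
rewrite ler_pM2l ?powR_gt0//; move: hk.
by rewrite ltr_pdivlMr// mulrAC ltr_pdivrMr// (mulrC _ c) => /ltW.
Qed.

Lemma tail_cvg0 (t : R) : 0 < t -> exists k : nat, tail (2 ^+ k) <= t.
Proof.
move=> t0; pose F (k : nat) : set (measurableTypeR R) := [set x : R | 2 ^+ k <= x].
have F0 : \bigcap_n F n = set0.
  apply/seteqP; split => // x /(_ (Num.bound `|x|) I) /=; apply/negP.
  rewrite -ltNge (le_lt_trans (ler_norm x))//.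
  rewrite (lt_trans (archi_boundP (normr_ge0 x)))// -natrX ltr_nat.
  exact: ltn_expl.
have : (mu \o F) x @[x --> \oo] --> mu (\bigcap_n F n).
  apply: nonincreasing_cvg_mu.
  - by rewrite (le_lt_trans _ (ltry 1))// probability_le1//; exact: measurable_ge.
  - by move=> k; exact: measurable_ge.
  - by rewrite F0.
  - move=> a b ab; apply/subsetPset => x /=; apply: le_trans.
    by rewrite ler_weXn2l ?ler1n.
rewrite F0 measure0 => /fine_cvgP[_ /cvgr_lt /(_ t t0)] [k _ hk].
by exists k; apply: ltW; exact: (hk k (leqnn k)).
Qed.

(** The tail at most halves from one power of two to the next, so that along
    powers of two it comes within a factor 2 of every small level. *)
Lemma tail_level (k0 : nat) :
  (forall k : nat, (k0 <= k)%N -> tail (2 ^+ k) <= 2 * tail (2 ^+ k.+1)) ->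
  forall t : R, 0 < t -> t < tail (2 ^+ k0) ->
  exists k : nat, [/\ (k0 <= k)%N, t / 2 <= tail (2 ^+ k) & tail (2 ^+ k) <= t].
Proof.
move=> half t t0 tk0.
have ex : exists k, tail (2 ^+ (k0 + k)) <= t.
  have [k hk] := tail_cvg0 t0; exists k; apply: le_trans hk.
  apply: le_prob; [exact: measurable_ge|exact: measurable_ge|].
  by move=> x /=; apply: le_trans; rewrite ler_weXn2l ?ler1n// leq_addl.
case: (ex_minnP ex) => -[|k] kt kmin.
  by move: kt; rewrite addn0 leNgt tk0.
exists (k0 + k.+1)%N; split=> //; first exact: leq_addr.
have : t < tail (2 ^+ (k0 + k)).
  by rewrite ltNge; apply/negP => /kmin; rewrite ltnn.
have := half (k0 + k)%N (leq_addr _ _); rewrite addnS; lra.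
Qed.

(** Capping, rather than cutting off at [y], keeps a term which exceeds [y] large
    enough to make a sum exceed [y] by itself. *)
Definition cap (y x : R) : R := Num.min `|x| y.

Lemma measurable_cap (y : R) : measurable_fun setT (cap y).
Proof. by apply: measurable_minr => //; exact: normr_measurable. Qed.

Lemma cap_ge0 (y x : R) : 0 <= y -> 0 <= cap y x.
Proof. by move=> y0; rewrite /cap le_min normr_ge0. Qed.

Hypothesis mu_ge0 : mu [set x : R | x < 0] = 0%E.

Lemma tail_norm (y : R) : 0 < y -> mu [set x : R | y <= `|x|] = (tail y)%:E.
Proof.
move=> y0; have mlt : measurable ([set x : R | x < 0] : set (measurableTypeR R)).
  rewrite (_ : [set x | _] = [set` `]-oo, 0[]); first exact: measurable_itv.
  by apply/seteqP; split => x /=; rewrite in_itv.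
have mle : measurable ([set x : R | y <= `|x|] : set (measurableTypeR R)).
  rewrite -[X in measurable X]setTI; have := @normr_measurable R setT.
  by move=> /(_ measurableT _ (measurable_ge y)).
rewrite probE//; congr EFin; apply/eqP; rewrite eq_le; apply/andP; split.
  rewrite -[leRHS]addr0 -[X in _ + X](_ : prob mu [set x : R | x < 0] = 0).
    apply: prob_le_add => //; first exact: measurable_ge.
    by move=> x /=; case: (ltrP x 0) => [|x0]; [right|left; rewrite -(ger0_norm x0)].
  by rewrite /prob mu_ge0.
apply: le_prob => //; first exact: measurable_ge.
by move=> x /= /le_trans; apply; exact: ler_norm.
Qed.

Definition cap_mean (y : R) : \bar R := (\int[mu]_x (cap y x)%:E)%E.

Lemma cap_mean_le (y : R) : 0 <= y -> (cap_mean y <= y%:E)%E.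
Proof.
move=> y0; rewrite -[leRHS]mule1 -(probability_setT mu) -integral_cst//.
apply: ge0_le_integral => //.
- by move=> x _; rewrite lee_fin cap_ge0.
- by apply/measurable_EFinP; exact: measurable_cap.
- by move=> x _; rewrite lee_fin ge_min lexx orbT.
Qed.

Lemma cap_mean_double (y : R) : 0 < y ->
  (cap_mean (2 * y) <= cap_mean y + (y * tail y)%:E)%E.
Proof.
move=> y0; have mle : measurable ([set x : R | y <= `|x|] : set (measurableTypeR R)).
  rewrite -[X in measurable X]setTI; have := @normr_measurable R setT.
  by move=> /(_ measurableT _ (measurable_ge y)).
rewrite EFinM -tail_norm// -[X in mu X]setIT -integral_indic// -ge0_integralZl//=.
- rewrite -ge0_integralD//=.
  + apply: ge0_le_integral => //.
    * by move=> x _; rewrite lee_fin cap_ge0// mulr_ge0// ltW.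
    * by apply/measurable_EFinP; exact: measurable_cap.
    * apply: emeasurable_funD; first by apply/measurable_EFinP; exact: measurable_cap.
      by apply/measurable_EFinP; apply: measurable_funM => //.
    * move=> x _; rewrite lee_fin /cap indicE; case: (leP y `|x|) => yx.
        by rewrite mem_set//= mulr1 ge_min; apply/orP; right; lra.
      by rewrite memNset ?mulr0 ?addr0 ?ge_min ?lexx//=; apply/negP; rewrite -ltNge.
  + by move=> x _; rewrite lee_fin cap_ge0// ltW.
  + by apply/measurable_EFinP; exact: measurable_cap.
  + by move=> x _; rewrite lee_fin mulr_ge0// ltW.
  + by apply/measurable_EFinP; apply: measurable_funM => //.
- by apply/measurable_EFinP.
- by rewrite lee_fin ltW.
Qed.

(** Truncated means are of the order of [y * tail y], as in Karamata's theorem: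
    passing from [y] to [2 * y] adds at most [y * tail y] to the mean, while
    [y * tail y] itself grows by a factor [2 * r > 1]. *)
Lemma cap_mean_tail : exists (C : R) (k0 : nat), 0 < C /\
  forall k : nat, (k0 <= k)%N ->
    [/\ 0 < tail (2 ^+ k), tail (2 ^+ k) <= 2 * tail (2 ^+ k.+1) &
      (cap_mean (2 ^+ k) <= (C * (2 ^+ k * tail (2 ^+ k)))%:E)%E].
Proof.
have [r [k0 [r1 hr]]] := tail_ratio.
have [t0 _] := hr k0 (leqnn _).
(* The first summand serves the threshold [2 ^+ k0], the second one makes the
   bound propagate: [C + 1 <= 2 * r * C]. *)
pose C := (tail (2 ^+ k0))^-1 + (2 * r - 1)^-1.
have r3 : 0 < 2 * r - 1 by lra.
have C0 : 0 < C by rewrite /C addr_gt0 ?invr_gt0.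
exists C, k0; split=> // k k0k; have [tk htk] := hr k k0k; split=> //.
  have : 2^-1 * tail (2 ^+ k) <= r * tail (2 ^+ k) by rewrite ler_pM2r// ltW.
  lra.
rewrite -(subnKC k0k); elim: (k - k0)%N => [|m IH].
  rewrite addn0; apply: (le_trans (cap_mean_le (exprn_ge0 _ (ler0n _ _)))).
  rewrite lee_fin mulrCA -[leLHS]mulr1 ler_pM2l ?exprn_gt0//.
  by rewrite -ler_pdivrMr// mul1r /C lerDl invr_ge0 ltW.
have [tm htm] := hr (k0 + m)%N (leq_addr _ _).
rewrite addnS exprS; apply: (le_trans (cap_mean_double (exprn_gt0 _ _))) => //.
apply: (le_trans (leeD2r _ IH)); rewrite -EFinD lee_fin.
have Cr : 1 <= C * (2 * r - 1).
  by rewrite mulrDl mulVf ?gt_eqF// lerDr mulr_ge0// ltW// invr_gt0.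
have p0 : 0 < 2 ^+ (k0 + m) :> R by rewrite exprn_gt0.
rewrite exprS in htm.
rewrite (_ : C * (2 * _ * _) = 2 * C * 2 ^+ (k0 + m) * tail (2 * 2 ^+ (k0 + m)));
  last by ring.
apply: (@le_trans _ _ (2 * C * 2 ^+ (k0 + m) * (r * tail (2 ^+ (k0 + m))))).
  rewrite -subr_ge0 (_ : _ - _ =
    2 ^+ (k0 + m) * tail (2 ^+ (k0 + m)) * (C * (2 * r - 1) - 1)); last by ring.
  by rewrite mulr_ge0 ?subr_ge0// ltW// mulr_gt0.
by rewrite ler_pM2l ?mulr_gt0.
Qed.

End heavy_tail.

(** * Sums of independent heavy-tailed variables *)

Lemma measurable_sum_cond (R : realType) (d : measure_display)
    (T : measurableType d) (I : finType) (B : pred I) (h : I -> T -> R) :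
  (forall i, measurable_fun setT (h i)) ->
  measurable_fun setT (fun w => \sum_(i | B i) h i w).
Proof.
move=> mh; rewrite (_ : (fun w => _) = fun w => \sum_(i <- enum B) h i w).
  exact: measurable_sum.
by apply/funext => w; rewrite big_enum.
Qed.

Section iid_family.
Context (R : realType) (d : measure_display) (T : measurableType d)
  (P : probability T R) (I : finType) (X : I -> {RV P >-> R})
  (mu : probability (measurableTypeR R) R).
Hypothesis iidX : iid X mu.

Lemma measurable_RV (f : T -> R) (A : set R) :
  measurable_fun setT f -> measurable A -> measurable (f @^-1` A).
Proof. by move=> mf mA; rewrite -[_ @^-1` _]setTI; exact: mf. Qed.

Lemma measurable_preim (i : I) (A : set R) :
  measurable A -> measurable (X i @^-1` A).
Proof. by apply: measurable_RV. Qed.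

Lemma prob_iid (i : I) (A : set R) :
  measurable A -> prob P (X i @^-1` A) = prob mu A.
Proof. by move=> mA; rewrite /prob -(iidX.1 i A mA). Qed.

Lemma iid_inter (s : {set I}) (A : set R) : measurable A ->
  prob P (\bigcap_(i in [set` s]) X i @^-1` A) = prob mu A ^+ #|s|.
Proof.
move=> mA; rewrite /prob (iidX.2 s (fun=> A))//.
rewrite (eq_bigr (fun=> (prob mu A)%:E)).
  by rewrite prodEFin prodr_const.
by move=> i _; rewrite -(prob_iid i mA) -probE//; exact: measurable_preim.
Qed.

Lemma iid_pair (i k : I) (A B : set R) : i != k ->
  measurable A -> measurable B ->
  P (X i @^-1` A `&` X k @^-1` B) = (prob mu A * prob mu B)%:E.
Proof.
move=> ik mA mB; pose F l := if l == i then A else B.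
have -> : X i @^-1` A `&` X k @^-1` B =
    \bigcap_(l in [set` [set i; k]%SET]) X l @^-1` F l.
  apply/seteqP; split => w /=.
    move=> [wA wB] l /=; rewrite !inE /F => /orP[]/eqP ->; rewrite ?eqxx//.
    by rewrite eq_sym (negbTE ik).
  move=> h; split.
    by have := h i; rewrite /F /= !inE eqxx; exact.
  by have := h k; rewrite /F /= !inE eqxx orbT eq_sym (negbTE ik); exact.
rewrite (iidX.2 [set i; k]%SET F); last by move=> l; rewrite /F; case: ifP.
rewrite big_setU1 ?inE//= big_set1 /F eqxx eq_sym (negbTE ik).
rewrite EFinM -(prob_iid i mA) -(prob_iid k mB) -!probE//;
  exact: measurable_preim.
Qed.

(** Restricted to the event that [X i] lies in [A], the law of [X k] is a multiple
    of [mu], by independence of the pair. *)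
Lemma iid_integral_le (i k : I) (A : set R) (g : R -> \bar R) : i != k ->
  measurable A -> measurable_fun setT g -> (forall x, (0 <= g x)%E) ->
  (\int[P]_(w in X i @^-1` A) g (X k w) <= (prob mu A)%:E * \int[mu]_x g x)%E.
Proof.
move=> ik mA mg g0; have mD := measurable_preim i mA.
rewrite (eq_measure_integral (mrestr P mD)) => [|B mB BD]; last first.
  by rewrite /= /mrestr setIidl.
apply: (@le_trans _ _ (\int[mrestr P mD]_w g (X k w))%E).
  apply: ge0_subset_integral => //.
  exact: measurableT_comp.
have mXk : measurable_fun setT (X k : T -> measurableTypeR R).
  by move=> mT B mB; exact: (measurable_funPT (X k) mT B mB).
rewrite -(@ge0_integral_pushforward _ _ _ (measurableTypeR R) _ _ mXk (mrestr P mD) setT g)//.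
pose p : {nonneg R} := NngNum (prob_ge0 mu A).
have -> : (\int[pushforward (mrestr P mD) (X k : T -> measurableTypeR R)]_x g x =
    \int[mscale p mu]_x g x)%E.
  apply: eq_measure_integral => B mB _.
  by rewrite /= /pushforward /mrestr setIC iid_pair// EFinM /mscale/= -(probE mu mB).
by rewrite ge0_integral_mscale.
Qed.

(** Markov's inequality for the sum of capped terms: a sum which reaches [y]
    still does so after each term is capped at [y]. Pairwise independence is
    enough for the expectations. *)
Lemma large_and_large_sum (y C : R) (i : I) (B : pred I) : 0 < y -> ~~ B i ->
  (cap_mean mu y <= (C * (y * tail mu y))%:E)%E ->
  prob P ([set w | y <= X i w] `&` [set w | y <= \sum_(k | B k) `|X k w| ]) <=
  #|B|%:R * (C * tail mu y ^+ 2).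
Proof.
move=> y0 nBi hC; set E := _ `&` _.
pose D := [set w | y <= X i w].
have mD : measurable D by exact: (measurable_preim i (measurable_ge y)).
have mX k : measurable_fun setT (fun w => (cap y (X k w))%:E).
  apply/measurable_EFinP.
  by apply: (measurableT_comp (measurable_cap y)).
have mE : measurable E.
  apply: measurableI => //.
  apply: (measurable_RV _ (measurable_ge y)).
  apply: measurable_sum_cond => k; exact: measurableT_comp.
rewrite -(ler_pM2l y0).
have EP : (y * prob P E)%:E = (\int[P]_(w in D) (y * \1_E w)%:E)%E.
  under eq_integral do rewrite EFinM.
  rewrite ge0_integralZl//; last by rewrite lee_fin ltW.
    rewrite integral_indic// EFinM -probE// setIidl//.
    by move=> w [].
  by apply/measurable_EFinP.
rewrite -lee_fin EP.
apply: (@le_trans _ _ (\int[P]_(w in D) (\sum_(k <- enum B) (cap y (X k w))%:E))%E).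
  apply: ge0_le_integral => //.
  - by move=> w _; rewrite lee_fin mulr_ge0// ltW.
  - by apply/measurable_EFinP; apply: measurable_funM => //.
  - by apply: emeasurable_sum => k; exact: measurable_funTS.
  move=> w Dw; rewrite sumEFin lee_fin big_enum indicE.
  have [Ew|nE] := pselect (E w); last first.
    by rewrite memNset// mulr0 sumr_ge0// => k _; rewrite cap_ge0// ltW.
  rewrite mem_set// mulr1; have [_ /= yS] := Ew.
  have [/existsP[k /andP[Bk yk]]|] := boolP [exists k, B k && (y <= `|X k w|)].
    rewrite (bigD1 k)//= {1}/cap (min_idPr yk) lerDl sumr_ge0// => l _.
    by rewrite cap_ge0// ltW.
  move=> /existsPn small; apply: (le_trans yS); apply: ler_sum => k Bk.
  have := small k; rewrite Bk /= -ltNge => /ltW xy.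
  by rewrite /cap (min_idPl xy).
rewrite ge0_integral_sum//; last 2 first.
- by move=> k; exact: measurable_funTS.
- by move=> k w _; rewrite lee_fin cap_ge0// ltW.
rewrite big_enum; apply: (@le_trans _ _ (\sum_(k | B k) (tail mu y * (C * (y * tail mu y)))%:E)%E).
  apply: lee_sum => k Bk.
  apply: (le_trans (@iid_integral_le i k _ (fun x => (cap y x)%:E) _ (measurable_ge y) _ _)).
  - by apply: contraNneq nBi => ->.
  - by apply/measurable_EFinP; exact: measurable_cap.
  - by move=> x; rewrite lee_fin cap_ge0// ltW.
  by rewrite EFinM; apply: lee_wpmul2l => //; rewrite lee_fin prob_ge0.
rewrite sumEFin lee_fin sumr_const -[leLHS]mulr_natl.
by rewrite le_eqVlt; apply/orP; left; apply/eqP; ring.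
Qed.

End iid_family.

(** * Energy along a good edge *)

Definition incident (n : nat) (i : 'I_n) (e : edge n) : bool :=
  (i == (val e).1) || (i == (val e).2).

Definition rest_sum (R : realType) (n : nat) (j : couplings R n) (e : edge n)
    (i : 'I_n) : R :=
  \sum_(e' | incident i e' && (e' != e)) `|j e'|.

(** Comparing the edge and the other couplings with a deterministic threshold,
    instead of with each other, makes the probability of this event easy to
    bound by independence. *)
Definition good_edge (R : realType) (n : nat) (y : R) (j : couplings R n)
    (e : edge n) : bool :=
  [&& y <= j e, rest_sum j e (val e).1 < y & rest_sum j e (val e).2 < y].

Lemma edge_neq (n : nat) (e : edge n) : (val e).1 != (val e).2.
Proof. by have := valP e; rewrite ltn_neqAle => /andP[]. Qed.

Lemma rest_sum_lt (R : realType) (n : nat) (y : R) (j : couplings R n)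
    (e : edge n) (i : 'I_n) :
  good_edge y j e -> incident i e -> rest_sum j e i < j e.
Proof.
move=> /and3P[ye r1 r2] /orP[] /eqP ->; exact: lt_le_trans ye.
Qed.

Lemma spin_flip (R : realType) (n : nat) (s : state n) (i k : 'I_n) :
  spin R (flip i s) k = (if k == i then -1 else 1) * spin R s k.
Proof.
rewrite /spin ffunE; case: eqP => _; last by rewrite mul1r.
by case: (s k); rewrite /= ?mulN1r ?opprK.
Qed.

Lemma hamiltonian_flip (R : realType) (n : nat) (j : couplings R n)
    (s : state n) (i : 'I_n) :
  hamiltonian j (flip i s) - hamiltonian j s =
  2 / n%:R * \sum_(e | incident i e) j e * spin R s (val e).1 * spin R s (val e).2.
Proof.
rewrite /hamiltonian opprK addrC -mulrBr -sumrB -mulrA [RHS]mulrCA.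
congr (_ * _); rewrite mulr_sumr [RHS]big_mkcond; apply: eq_bigr => e _.
rewrite !spin_flip /incident !(eq_sym i); have := edge_neq e.
have [->|_] := eqVneq (val e).1 i; have [->|_] := eqVneq (val e).2 i => /=.
- by move=> /negP[].
- by move=> _; ring.
- by move=> _; ring.
- by move=> _; ring.
Qed.

Lemma norm_spin (R : realType) (n : nat) (s : state n) (i : 'I_n) :
  `|spin R s i| = 1.
Proof. by rewrite /spin; case: ifP => _; rewrite ?normrN normr1. Qed.

Lemma spin_agree (R : realType) (n : nat) (s : state n) (a b : 'I_n) :
  spin R s a * spin R s b = if s a == s b then 1 else -1.
Proof. by rewrite /spin; case: (s a); case: (s b); rewrite /=; ring. Qed.

(** The energy change of a spin flip is governed by the local field; at an
    endpoint of a good edge, the other couplings cannot outweigh that edge. *)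
Lemma good_edge_field (R : realType) (n : nat) (y : R) (j : couplings R n)
    (e : edge n) (s : state n) (i : 'I_n) :
  good_edge y j e -> incident i e ->
  if s (val e).1 == s (val e).2 then hamiltonian j s < hamiltonian j (flip i s)
  else hamiltonian j (flip i s) < hamiltonian j s.
Proof.
move=> ge ie; have rlt := rest_sum_lt ge ie.
have n_gt0 : 0 < 2 / n%:R :> R.
  by rewrite divr_gt0// ltr0n; case: (n) i {s ie rlt e ge j} => // -[].
have := hamiltonian_flip j s i; rewrite (bigD1 e)//= -[j e * _ * _]mulrA spin_agree.
set r := \sum_(_ | _) _; have : `|r| < j e.
  apply: le_lt_trans rlt; apply: le_trans (ler_norm_sum _ _ _) _.
  by apply: ler_sum => f _; rewrite !normrM !norm_spin !mulr1.
rewrite ltr_norml => /andP[r1 r2] E.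
case: ifPn E => _ E.
  by rewrite -subr_gt0 E mulr_gt0// mulr1 addrC -(opprK (j e)) subr_gt0.
by rewrite -subr_lt0 E pmulr_rlt0// mulrN1 addrC subr_lt0.
Qed.

Lemma hamming1_flip (n : nat) (s s' : state n) :
  hamming s s' = 1%N -> exists i, s' = flip i s.
Proof.
move=> /eqP /cards1P[i Ei]; exists i; apply/ffunP => k; rewrite ffunE.
have /setP/(_ k) := Ei; rewrite !inE => <-.
by case: (s k); case: (s' k).
Qed.

(** Two good edges cannot share a vertex: each would be part of what the other
    must dominate there. *)
Lemma good_edge_disjoint (R : realType) (n : nat) (y : R) (j : couplings R n)
    (e f : edge n) (i : 'I_n) :
  good_edge y j e -> good_edge y j f -> incident i e -> incident i f -> e = f.
Proof.
move=> ge gf ie jf; apply/eqP/negP => /negP nef.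
have /and3P[_ e1 e2] := ge; have /and3P[yf _ _] := gf.
have : rest_sum j e i < y by case/orP: ie => /eqP ->.
apply/negP; rewrite -leNgt; apply: (le_trans yf).
rewrite /rest_sum (bigD1 f) /=; last by rewrite jf eq_sym.
by rewrite (le_trans (ler_norm _))// lerDl sumr_ge0.
Qed.

(** Minimising the energy with one good edge held at +1 and another one at -1
    gives a local minimum: the held spins do not want to flip, and flipping
    another spin respects the constraint. *)
Lemma good_edges_local_minimum (R : realType) (n : nat) (y : R)
    (j : couplings R n) (e f : edge n) :
  e != f -> good_edge y j e -> good_edge y j f ->
  exists s : state n, local_minimum j s.
Proof.
move=> nef ge gf.
have dis i : incident i e -> ~~ incident i f.
  by move=> ie; apply: contra nef => jf; apply/eqP; exact: good_edge_disjoint ge gf ie jf.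
pose C (s : state n) := [forall i, (incident i e ==> s i) &&
   (incident i f ==> ~~ s i)].
have C0 : C [ffun i => incident i e].
  apply/forallP => i; rewrite !ffunE implybb /=; apply/implyP => jf.
  by apply/negP => /dis; rewrite jf.
case: (@arg_minP _ _ _ [ffun i => incident i e] C (hamiltonian j) C0).
move=> s /forallP Cs smin; exists s.
have inc1 (g : edge n) : incident (val g).1 g by rewrite /incident eqxx.
have inc2 (g : edge n) : incident (val g).2 g by rewrite /incident eqxx orbT.
have se i : incident i e -> s i.
  by move=> ie; have /andP[/implyP/(_ ie)] := Cs i.
have sf i : incident i f -> s i = false.
  by move=> jf; have /andP[_ /implyP/(_ jf) /negbTE] := Cs i.
split.
- by move=> /ffunP/(_ (val f).1); rewrite ffunE sf.
- by move=> /ffunP/(_ (val e).1); rewrite ffunE se.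
move=> s' /hamming1_flip[i ->].
have [ie|nie] := boolP (incident i e).
  have := good_edge_field s ge ie.
  by rewrite (se _ (inc1 e)) (se _ (inc2 e)) eqxx => /ltW.
have [jf|njf] := boolP (incident i f).
  have := good_edge_field s gf jf.
  by rewrite (sf _ (inc1 f)) (sf _ (inc2 f)) eqxx => /ltW.
apply: smin; apply/forallP => k; rewrite ffunE.
by case: eqP => [->|_]; rewrite ?(negbTE nie) ?(negbTE njf) ?Cs.
Qed.

(** * Measurability and counting *)

(** The couplings are just measurable functions here, so that these results also
    apply to the sigma-algebra which the couplings generate. *)
Section measurability.
Context (R : realType) (d : measure_display) (T : measurableType d) (n : nat)
  (X : edge n -> T -> R).
Hypothesis mX : forall e, measurable_fun setT (X e).

Lemma measurable_rest_sum (e : edge n) (i : 'I_n) :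
  measurable_fun setT (fun w => rest_sum (fun e => X e w) e i).
Proof. by apply: measurable_sum_cond => k; exact: measurableT_comp. Qed.

Lemma measurable_good_edge (y : R) (e : edge n) :
  measurable [set w | good_edge y (fun e => X e w) e].
Proof.
have mlt i : measurable [set w | rest_sum (fun e => X e w) e i < y].
  rewrite (_ : [set w | _] =
    ~` ((fun w => rest_sum (fun e => X e w) e i) @^-1` [set x | y <= x])).
    apply: measurableC; apply: measurable_RV (measurable_ge y).
    exact: measurable_rest_sum.
  by apply/seteqP; split => w /=; rewrite ltNge => /negP.
rewrite (_ : [set w | _] = X e @^-1` [set x | y <= x] `&`
    ([set w | rest_sum (fun e => X e w) e (val e).1 < y] `&`
     [set w | rest_sum (fun e => X e w) e (val e).2 < y])).
  apply: measurableI; last exact: measurableI.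
  exact: measurable_RV (measurable_ge y).
apply/seteqP; split => w /=; first by move=> /and3P[].
by move=> [? [? ?]]; apply/and3P.
Qed.

Lemma measurable_hamiltonian (s : state n) :
  measurable_fun setT (fun w => hamiltonian (fun e => X e w) s).
Proof.
apply: measurableT_comp => //; apply: measurable_funM => //.
apply: measurable_sum_cond => e.
by apply: measurable_funM => //; apply: measurable_funM.
Qed.

Lemma measurable_local_minimum :
  measurable [set w | exists s, local_minimum (fun e => X e w) s].
Proof.
rewrite (_ : [set w | _] = \bigcup_(s in [set s : state n |
      s <> [ffun=> true] /\ s <> [ffun=> false]])
    \bigcap_(s' in [set s' | hamming s s' = 1%N])
    (fun w => hamiltonian (fun e => X e w) s' - hamiltonian (fun e => X e w) s)
      @^-1` [set x | 0 <= x]).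
  apply: fin_bigcup_measurable; first exact: finite_finset.
  move=> s _; apply: fin_bigcap_measurable; first exact: finite_finset.
  move=> s' _; apply: measurable_RV (measurable_ge 0).
  by apply: measurable_funB; exact: measurable_hamiltonian.
apply/seteqP; split => w /=.
  by move=> [s [s1 s2 smin]]; exists s => // s' h; rewrite /= subr_ge0 smin.
move=> [s [s1 s2] smin]; exists s; split=> // s' h.
by have := smin s' h; rewrite /= subr_ge0.
Qed.

End measurability.

Lemma card_edge (n : nat) : #|{: edge n}| = 'C(n, 2).
Proof.
rewrite card_sub -sum1_card big_mkcond /=.
rewrite -(pair_bigA _ (fun i k : 'I_n => if (i < k)%N then 1 else 0)%N) /=.
rewrite exchange_big /= -bin2_sum [RHS]big_mkord; apply: eq_bigr => k _.
by rewrite -big_mkcond -(big_ord_widen _ (fun=> 1%N)) 1?ltnW// sum1_card card_ord.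
Qed.

Lemma card_incident (n : nat) (i : 'I_n) : (#|incident i| <= n + n)%N.
Proof.
have card1 (D : {set edge n}) (h : edge n -> 'I_n) :
    {in D &, injective h} -> (#|D| <= n)%N.
  by move=> hinj; rewrite -(card_in_imset hinj) -[leqRHS](card_ord n) max_card.
have eqe (e f : edge n) : (val e).1 = (val f).1 -> (val e).2 = (val f).2 -> e = f.
  move=> h1 h2; apply: val_inj.
  by rewrite [LHS]surjective_pairing [RHS]surjective_pairing h1 h2.
rewrite (_ : #|incident i| = #|[set e : edge n | i == (val e).1] :|:
    [set e : edge n | i == (val e).2]|).
  apply: (leq_trans (leq_card_setU _ _)); apply: leq_add.
    apply: (card1 _ (fun e => (val e).2)) => e f; rewrite !inE => /eqP h1 /eqP h2.
    by apply: eqe; rewrite -h1.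
  apply: (card1 _ (fun e => (val e).1)) => e f; rewrite !inE => /eqP h1 /eqP h2.
  by move=> h; apply: eqe; rewrite -?h1.
by apply: eq_card => e; rewrite !inE.
Qed.

Lemma exists_half_sets (F : finType) : exists s1 s2 : {set F},
  [/\ (forall x, x \in s1 -> x \notin s2), (#|F| <= (2 * #|s1|).+1)%N & (#|F| <= (2 * #|s2|).+1)%N].
Proof.
pose k := #|F|./2.
pose s1 := [set x in take k (enum F)]%SET; exists s1, (~: s1)%SET.
have c1 : #|s1| = k.
  rewrite cardsE (card_uniqP _) ?take_uniq ?enum_uniq// size_take -cardE.
  by case: ltnP => // h; apply/eqP; rewrite eqn_leq h /k -divn2 leq_div.
have := cardsC s1; have := odd_double_half #|F|; rewrite c1 -/k -mul2n => h1 h2.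
split; first by move=> x xs; rewrite inE negbK.
  by rewrite -[leqLHS]h1; case: odd => /=; lia.
by move: h1; case: odd => /=; lia.
Qed.

(** Bernoulli's inequality for [(1 - p)^-1]: a crude form of exponential decay. *)
Lemma bernoulli_decay (R : realType) (p : R) (m : nat) : 0 <= p -> p <= 1 ->
  (1 - p) ^+ m <= (1 + m%:R * p)^-1.
Proof.
move=> p0 p1; have pos k : 0 < 1 + k%:R * p by rewrite ltr_pwDl// mulr_ge0.
rewrite -[leRHS]mul1r ler_pdivlMr//; elim: m => [|m IH].
  by rewrite mul0r addr0 mulr1.
apply: le_trans IH; rewrite exprSr -mulrA ler_wpM2l ?exprn_ge0 ?subr_ge0//.
rewrite -natr1; have : 0 <= (m%:R + 1) * p ^+ 2 by rewrite mulr_ge0 ?addr_ge0 ?sqr_ge0.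
nra.
Qed.

(** * Probability of good edges and of local minima *)

Section good_edge_prob.
Context (R : realType) (d : measure_display) (T : measurableType d)
  (P : probability T R) (n : nat) (X : edge n -> {RV P >-> R})
  (mu : probability (measurableTypeR R) R) (y C : R).
Hypotheses (iidX : iid X mu) (y0 : 0 < y) (C0 : 0 < C)
  (hC : (cap_mean mu y <= (C * (y * tail mu y))%:E)%E).

Let mX e : measurable_fun setT (X e). Proof. by []. Qed.
Let p := tail mu y.

Let big e := [set w | y <= X e w].
Let good e := [set w | good_edge y (fun e => X e w) e].

Let mbig e : measurable (big e).
Proof. exact: measurable_RV (measurable_ge y). Qed.

Let mgood e : measurable (good e).
Proof. exact: measurable_good_edge. Qed.

Lemma prob_big e : prob P (big e) = p.
Proof. exact: (prob_iid iidX e (measurable_ge y)). Qed.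

(** A large edge fails to be good only if the other couplings at one of its
    endpoints have a large sum, and each of them is independent of the edge. *)
Lemma prob_not_good e :
  prob P (big e `&` ~` good e) <= (4 * n)%:R * (C * p ^+ 2).
Proof.
pose S i := [set w | y <= \sum_(k | incident i k && (k != e)) `|X k w| ].
have mS i : measurable (S i).
  apply: measurable_RV (measurable_ge y).
  exact: (measurable_rest_sum mX e i).
have boundS i : prob P (big e `&` S i) <= (n + n)%:R * (C * p ^+ 2).
  apply: (le_trans (large_and_large_sum iidX _ _ hC)) => //.
    by rewrite eqxx andbF.
  rewrite ler_wpM2r//; first by rewrite mulr_ge0 ?sqr_ge0// ltW.
  rewrite ler_nat; apply: leq_trans (card_incident i).
  by apply: subset_leq_card; apply/fintype.subsetP => k; rewrite !unfold_in => /andP[].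
have : prob P (big e `&` ~` good e) <=
    prob P (big e `&` S (val e).1) + prob P (big e `&` S (val e).2).
  apply: prob_le_add; do ?exact: measurableI.
    by apply: measurableI => //; exact: measurableC.
  move=> w [bw ng]; have [s1|s1] := ltrP (rest_sum (fun e => X e w) e (val e).1) y.
    have [s2|s2] := ltrP (rest_sum (fun e => X e w) e (val e).2) y.
      by exfalso; apply: ng; apply/and3P; split.
    by right; split.
  by left; split.
move=> /le_trans; apply; apply: (le_trans (lerD (boundS _) (boundS _))).
rewrite -mulrDl -natrD ler_wpM2r//; last by rewrite ler_nat; lia.
by rewrite mulr_ge0 ?sqr_ge0// ltW.
Qed.

Lemma prob_good_ge e : p - (4 * n)%:R * (C * p ^+ 2) <= prob P (good e).
Proof.
rewrite lerBlDr -(prob_big e); apply: (@le_trans _ _ (prob P (good e) +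
    prob P (big e `&` ~` good e))); last by rewrite lerD2l prob_big prob_not_good.
apply: prob_le_add => //; first by apply: measurableI => //; exact: measurableC.
by move=> w bw; have [|] := pselect (good e w); [left|right].
Qed.

Lemma prob_no_big (s : {set edge n}) :
  prob P (\bigcap_(e in [set` s]) X e @^-1` [set x | x < y]) <=
  (1 + #|s|%:R * p)^-1.
Proof.
have mlt : measurable ([set x : R | x < y] : set (measurableTypeR R)).
  rewrite (_ : [set x | _] = ~` [set x | y <= x]).
    by apply: measurableC; exact: measurable_ge.
  by apply/seteqP; split => x /=; rewrite ltNge => /negP.
rewrite (iid_inter iidX)// (_ : prob mu _ = 1 - p).
  by apply: bernoulli_decay; [exact: prob_ge0|apply: prob_le1; exact: measurable_ge].
rewrite -prob_setC; last exact: measurable_ge.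
by congr prob; apply/seteqP; split => x /=; rewrite ltNge => /negP.
Qed.

(** When every large edge is good, two distinct large edges give a local
    minimum, so it suffices to find one in each of two disjoint sets. *)
Lemma prob_no_local_minimum (s1 s2 : {set edge n}) :
  (forall e, e \in s1 -> e \notin s2) ->
  prob P (~` [set w | exists s, local_minimum (fun e => X e w) s]) <=
  (1 + #|s1|%:R * p)^-1 + (1 + #|s2|%:R * p)^-1 +
  #|{: edge n}|%:R * ((4 * n)%:R * (C * p ^+ 2)).
Proof.
move=> dis; pose none (s : {set edge n}) := \bigcap_(e in [set` s]) X e @^-1` [set x | x < y].
have mnone s : measurable (none s).
  apply: fin_bigcap_measurable => [|e _]; first exact: finite_finset.
  rewrite (_ : _ @^-1` _ = ~` big e); first exact: measurableC.
  by apply/seteqP; split => w /=; rewrite ltNge => /negP.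
pose bad := \big[setU/set0]_(e : edge n) (big e `&` ~` good e).
have mbad e : measurable (big e `&` ~` good e).
  by apply: measurableI => //; exact: measurableC.
have mBad : measurable bad by exact: bigsetU_measurable.
have mLM := measurableC (measurable_local_minimum mX).
apply: (@le_trans _ _ (prob P (none s1 `|` none s2) + prob P bad)).
  apply: prob_le_add => //; first exact: measurableU.
  move=> w nLM; have [[e se be]|n1] := pselect (exists2 e, e \in s1 & y <= X e w);
    last first.
    left; left => e /= es; rewrite ltNge; apply/negP => ye; apply: n1.
    by exists e.
  have [[f sf bf]|n2] := pselect (exists2 e, e \in s2 & y <= X e w); last first.
    left; right => f /= fs; rewrite ltNge; apply/negP => ye; apply: n2.
    by exists f.
  right; rewrite /bad -bigcup_seq; apply: contrapT => nbad; apply: nLM.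
  have allgood g : y <= X g w -> good_edge y (fun e => X e w) g.
    move=> bg; apply: contrapT => ng; apply: nbad.
    by exists g => //=; rewrite mem_index_enum.
  apply: (good_edges_local_minimum _ (allgood e be) (allgood f bf)).
  by apply: contraTneq sf => <-; exact: dis.
apply: lerD.
  apply: (le_trans (prob_le_add _ _ (mnone s1) (mnone s2) (@subset_refl _ _))).
    exact: measurableU.
  by apply: lerD; exact: prob_no_big.
apply: (le_trans (prob_bigU_le _ _ _ mbad)).
apply: (le_trans (ler_sum _ (fun e _ => prob_not_good e))).
by rewrite sumr_const [leRHS]mulr_natl.
Qed.

End good_edge_prob.

(** With tails of order [K / n ^ 2], about [K] large edges are expected, and the
    expected number of bad ones is of order [n ^ 3 * p ^ 2], that is [K ^ 2 / n]. *)
Lemma no_local_minimum_bound (R : realType) (C K p : R) (n M1 M2 : nat) :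
  0 < C -> 0 < K -> (2 < n)%N ->
  ('C(n.+1, 2) <= (2 * M1).+1)%N -> ('C(n.+1, 2) <= (2 * M2).+1)%N ->
  K / n%:R ^+ 2 / 2 <= p -> p <= K / n%:R ^+ 2 ->
  (1 + M1%:R * p)^-1 + (1 + M2%:R * p)^-1 +
    'C(n.+1, 2)%:R * ((4 * n.+1)%:R * (C * p ^+ 2)) <=
  2 / (1 + K / 8) + 8 * C * K ^+ 2 / n%:R.
Proof.
move=> C0 K0 n2 hM1 hM2 p1 p2.
have binE : ('C(n.+1, 2) + 'C(n.+1, 2) = n.+1 * n)%N.
  by rewrite bin2 addnn halfK /= oddM /= andNb subn0.
have n0 : 0 < n%:R :> R by rewrite ltr0n; lia.
have n20 : 0 < n%:R ^+ 2 :> R by rewrite exprn_gt0.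
have inv_le M : ('C(n.+1, 2) <= (2 * M).+1)%N ->
    (1 + M%:R * p)^-1 <= (1 + K / 8)^-1.
  move=> hM; have hM4 : (n ^ 2 <= 4 * M)%N by nia.
  have p0 : 0 <= p by apply: le_trans p1; rewrite !divr_ge0 ?ltW.
  have : K / 8 <= M%:R * p.
    apply: (@le_trans _ _ (M%:R * (K / n%:R ^+ 2 / 2))); last by rewrite ler_wpM2l.
    move: hM4; rewrite -(ler_nat R) natrX natrM => hM4.
    rewrite -mulrA -invfM mulrA ler_pdivlMr ?mulr_gt0//.
    have := ler_wpM2l (ltW K0) hM4; lra.
  move=> h; rewrite lef_pV2 ?posrE ?lerD2l//; first by rewrite ltr_pwDl// mulr_ge0.
  by rewrite ltr_pwDl// divr_ge0// ltW.
rewrite mulr2n mulrDl mul1r; apply: lerD; first by apply: lerD; exact: inv_le.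
have E1 : 'C(n.+1, 2)%:R <= n%:R ^+ 2 :> R by rewrite -natrX ler_nat; nia.
have E2 : (4 * n.+1)%:R <= 8 * n%:R :> R by rewrite -natrM ler_nat; lia.
have E3 : C * p ^+ 2 <= C * (K / n%:R ^+ 2) ^+ 2.
  rewrite ler_pM2l// ler_sqr ?nnegrE//; last by rewrite divr_ge0 ?ltW.
  by apply: le_trans p1; rewrite !divr_ge0 ?ltW.
have p20 : 0 <= C * p ^+ 2 by rewrite mulr_ge0 ?sqr_ge0 ?ltW.
apply: (@le_trans _ _ (n%:R ^+ 2 * (8 * n%:R * (C * (K / n%:R ^+ 2) ^+ 2)))).
  by apply: ler_pM => //; [rewrite mulr_ge0|apply: ler_pM].
rewrite le_eqVlt; apply/orP; left; apply/eqP; field.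
by rewrite gt_eqF.
Qed.

(** * Finite Markov chains *)

Section markov_chain_theory.
Context (R : realType) (d : measure_display) (W : measurableType d)
  (Q : probability W R) (S : finType) (K : S -> S -> R) (s0 : S)
  (X : nat -> W -> S).
Hypothesis chainX : markov_chain Q K s0 X.

Let mX t s : measurable [set w | X t w = s].
Proof. by have [] := chainX. Qed.

Lemma measurable_chain_in t (B : pred S) : measurable [set w | B (X t w)].
Proof. exact: measurable_fin_fun_in (mX t). Qed.

Lemma measurable_history t (x : nat -> S) :
  measurable [set w | forall k, (k <= t)%N -> X k w = x k].
Proof.
rewrite (_ : [set w | _] =
    \bigcap_(k in [set k | (k <= t)%N]) [set w | X k w = x k]).
  by apply: bigcap_measurableType.
by apply/seteqP; split => w h k; exact: h.
Qed.

(** The Markov property is about full histories: the law of one step is obtained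
    by summing over the histories up to time [t]. *)
Lemma chain_step t s s' :
  prob Q ([set w | X t w = s] `&` [set w | X t.+1 w = s']) =
  prob Q [set w | X t w = s] * K s s'.
Proof.
have [_ _ hK] := chainX.
pose Y w := [ffun k : 'I_t.+1 => X k w].
have YE (y : {ffun 'I_t.+1 -> S}) : [set w | Y w = y] =
    [set w | forall k, (k <= t)%N -> X k w = y (inord k)].
  apply/seteqP; split => w /=; first by move=> <- k kt; rewrite ffunE inordK.
  move=> h; apply/ffunP => k; rewrite ffunE h ?inord_val//.
  by rewrite -ltnS ltn_ord.
have mY y : measurable [set w | Y w = y].
  by rewrite YE; exact: measurable_history.
rewrite (prob_partition Q (mX t s) mY) mulr_suml.
rewrite (prob_partition Q (measurableI _ _ (mX t s) (mX t.+1 s')) mY).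
apply: eq_bigr => y _; have [ys|ys] := eqVneq (y ord_max) s; last first.
  have empty B : [set w | X t w = s] `&` B `&` [set w | Y w = y] = set0.
    apply/seteqP; split => // w [[Xs _] Yy]; move: ys.
    by rewrite -Xs -Yy ffunE eqxx.
  have := empty setT; rewrite setIT => ->.
  by rewrite empty /prob measure0 mul0r.
pose x k := if (k <= t)%N then y (inord k) else s'.
have Xx : [set w | X t w = s] `&` [set w | Y w = y] =
    [set w | forall k, (k <= t)%N -> X k w = x k].
  rewrite YE; apply/seteqP; split => w.
    by move=> [_ h] k kt; rewrite h// /x kt.
  move=> h; split => /= [|k kt]; last by rewrite h// /x kt.
  by rewrite h// /x leqnn -ys; congr (y _); apply: val_inj; rewrite /= inordK.
rewrite setIAC Xx; apply: EFin_inj; rewrite EFinM -!probE; last 2 first.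
- exact: measurable_history.
- by apply: measurableI => //; exact: measurable_history.
rewrite (_ : K s s' = K (x t) (x t.+1)); last first.
  rewrite /x leqnn ltnn -ys; congr (K (y _) _).
  by apply: val_inj; rewrite /= inordK.
rewrite -hK; congr (Q _); apply/seteqP; split => w.
  move=> [h Xs'] k; rewrite leq_eqVlt => /predU1P[->|]; last by rewrite ltnS; exact: h.
  by rewrite Xs' /x ltnn.
by move=> h; split => /= [k kt|]; rewrite h// /x ?ltnn// ltnW.
Qed.

Definition chain_mean t (f : S -> R) : R :=
  \sum_s prob Q [set w | X t w = s] * f s.

Lemma chain_mean0 f : chain_mean 0 f = f s0.
Proof.
have [_ Q0 _] := chainX.
have p0 : prob Q [set w | X 0 w = s0] = 1 by rewrite /prob Q0.
rewrite /chain_mean (bigD1 s0)//= p0 mul1r big1 ?addr0// => s ss0.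
suff -> : prob Q [set w | X 0 w = s] = 0 by rewrite mul0r.
apply/eqP; rewrite eq_le prob_ge0 andbT.
have : prob Q [set w | X 0 w = s] <= prob Q (~` [set w | X 0 w = s0]).
  apply: le_prob => //; first exact: measurableC.
  by move=> w /= -> /eqP; exact/negP.
by rewrite prob_setC// p0 subrr.
Qed.

Lemma chain_meanS t f :
  chain_mean t.+1 f = chain_mean t (fun s => \sum_s' K s s' * f s').
Proof.
rewrite /chain_mean; under [RHS]eq_bigr do rewrite mulr_sumr.
rewrite exchange_big; apply: eq_bigr => s' _.
rewrite (prob_partition Q (mX t.+1 s') (mX t)) mulr_suml.
by apply: eq_bigr => s _; rewrite setIC chain_step mulrA.
Qed.

Lemma chain_mean_indicator t (B : pred S) :
  chain_mean t (fun s => (B s)%:R) = prob Q [set w | B (X t w)].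
Proof.
rewrite (prob_partition Q (measurable_chain_in t B) (mX t)).
apply: eq_bigr => s _; have [Bs|Bs] := boolP (B s).
  rewrite mulr1; congr (prob Q _); apply/seteqP; split => w /=.
    by move=> ->; split.
  by case.
rewrite mulr0 (_ : _ `&` _ = set0) ?/prob ?measure0//.
by apply/seteqP; split => // w [/= + Xs]; rewrite Xs (negbTE Bs).
Qed.

Lemma chain_mean1 t : chain_mean t (fun=> 1) = 1.
Proof.
rewrite (chain_mean_indicator t predT) /prob.
by rewrite (_ : [set w | _] = setT) ?probability_setT//; apply/seteqP.
Qed.

Definition eventually_in (B : pred S) : set W :=
  [set w | exists t, forall k, (t <= k)%N -> B (X k w)].

Lemma measurable_eventually_in B : measurable (eventually_in B).
Proof.
rewrite (_ : eventually_in B =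
    \bigcup_t \bigcap_(k in [set k | (t <= k)%N]) [set w | B (X k w)]).
  apply: bigcupT_measurable => t; apply: bigcap_measurableType => k _.
  exact: measurable_chain_in.
by apply/seteqP; split => w [t h]; [exists t|exists t => // k; exact: h].
Qed.

(** A set which the chain cannot leave is, up to a countable union of null
    events, kept forever once it is visited. *)
Lemma absorbing_le (B : pred S) t :
  (forall s s', B s -> ~~ B s' -> K s s' = 0) ->
  prob Q [set w | B (X t w)] <= prob Q (eventually_in B).
Proof.
move=> absB; pose leave k := [set w | B (X k w)] `&` [set w | ~~ B (X k.+1 w)].
have mleave k : measurable (leave k).
  apply: measurableI; first exact: measurable_chain_in.
  exact: (@measurable_chain_in k.+1 (fun s => ~~ B s)).
have leave0 k : Q (leave k) = 0%E.
  rewrite probE//; congr (_%:E).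
  rewrite (prob_partition Q (mleave k) (mX k)) big1// => s _.
  rewrite (prob_partition Q (measurableI _ _ (mleave k) (mX k s)) (mX k.+1)).
  rewrite big1// => s' _; apply/eqP; rewrite eq_le prob_ge0 andbT.
  have [/andP[Bs Bs']|] := boolP (B s && ~~ B s').
    rewrite -[leRHS](mulr0 (prob Q [set w | X k w = s])) -(absB s s' Bs Bs').
    rewrite -chain_step.
    apply: le_prob; [|exact: measurableI|by apply: setSI; exact: subIsetr].
    by apply: measurableI => //; exact: measurableI.
  move=> nB; rewrite (_ : _ `&` _ = set0) ?/prob ?measure0//.
  apply/seteqP; split => // w [[[/= Bs Bs'] Xs] /= Xs']; move: nB.
  by rewrite -Xs Bs -Xs' Bs'.
have mL : measurable (\bigcup_k leave k) by exact: bigcupT_measurable.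
have L0 : prob Q (\bigcup_k leave k) = 0.
  have : Q.-negligible (\bigcup_k leave k).
    apply: negligible_bigcup => k; exists (leave k).
    by split; [exact: mleave|exact: leave0|].
  by move/(negligibleP Q mL); rewrite /prob => ->.
rewrite -[leRHS]addr0 -L0; apply: prob_le_add => //.
- exact: measurable_chain_in.
- exact: measurable_eventually_in.
move=> w /= Bt; have [L|nL] := pselect ((\bigcup_k leave k) w); first by right.
left; exists t => k tk; rewrite -(subnKC tk).
elim: (k - t)%N => [|m IH]; first by rewrite addn0.
rewrite addnS; apply/negP => /negP nB; apply: nL.
by exists (t + m)%N.
Qed.

End markov_chain_theory.

(** * Zero-temperature dynamics along a good edge *)

Lemma spin_infty_eventually (R : realType) (n : nat) (i : 'I_n)
    (x : nat -> state n) (b : bool) :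
  (exists t, forall k, (t <= k)%N -> x k i = b) ->
  spin_infty R i x = if b then 1 else -1.
Proof.
move=> [t xb]; rewrite /spin_infty.
have u_cst : \forall k \near \oo, spin R (x k) i = if b then 1 else -1.
  by exists t => // k tk; rewrite /spin xb.
rewrite asboolT; last exact: is_cvg_near_cst u_cst.
exact: (lim_near_cst (@Rhausdorff R) u_cst).
Qed.

(** A convergent sequence of spins is eventually constant. *)
Lemma spin_infty_oscillating (R : realType) (n : nat) (i : 'I_n)
    (x : nat -> state n) :
  ~ (exists t, forall k, (t <= k)%N -> x k i) ->
  ~ (exists t, forall k, (t <= k)%N -> ~~ x k i) -> spin_infty R i x = 0.
Proof.
move=> nt nf; rewrite /spin_infty; case: asboolP => // uc; exfalso.
have : \forall k \near \oo,
    `|limn (fun t => spin R (x t) i) - spin R (x k) i| < 1.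
  by move/cvgrPdist_lt : uc; apply.
move=> [t _ ht]; have near1 := ht t (leqnn t).
have same k : (t <= k)%N -> x k i = x t i.
  move=> tk; have := ht k tk; move: near1 => /=; rewrite /spin.
  by case: (x t i); case: (x k i) => //; rewrite !ltr_norml => /andP[? ?] /andP[? ?];
    lra.
case xt : (x t i).
  by apply: nt; exists t => k tk; rewrite same.
by apply: nf; exists t => k tk; rewrite same// xt.
Qed.

Section zero_temperature.
Context (R : realType) (n : nat) (j : couplings R n) (s0 : state n)
  (Z : zero_temp_dynamics j s0).

Let Q := dyn_law Z.
Let X := dyn_path Z.
Let chainX : markov_chain Q (transition j) s0 X := dyn_markov Z.

Lemma mean_spin_inftyE (i : 'I_n) : mean_spin_infty i Z =
  prob Q (eventually_in X (fun s => s i)) -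
  prob Q (eventually_in X (fun s => ~~ s i)).
Proof.
set A := eventually_in _ _; set B := eventually_in _ _.
have mA : measurable A by exact: measurable_eventually_in chainX _.
have mB : measurable B by exact: measurable_eventually_in chainX _.
have spinE w : spin_infty R i (fun t => dyn_path Z t w) = \1_A w - \1_B w.
  rewrite !indicE; have [Aw|nA] := pselect (A w).
    rewrite (mem_set Aw) memNset ?subr0; last first.
      move: Aw => [t At] [t' Bt]; have := Bt (maxn t t') (leq_maxr _ _).
      by rewrite At// leq_maxl.
    by rewrite (@spin_infty_eventually _ _ _ _ true).
  rewrite memNset//; have [Bw|nB] := pselect (B w).
    rewrite (mem_set Bw) sub0r (@spin_infty_eventually _ _ _ _ false)//.
    by have [t Bt] := Bw; exists t => k /Bt /negbTE.
  by rewrite memNset// subr0 spin_infty_oscillating.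
rewrite /mean_spin_infty unlock; under eq_integral do rewrite spinE EFinB.
rewrite integralB_EFin//; try exact: integrable_indic.
by rewrite !integral_indic// !setIT fineB ?fin_num_measure.
Qed.

End zero_temperature.

Lemma flip_neq (n : nat) (s : state n) (i : 'I_n) : flip i s != s.
Proof. by apply/eqP => /ffunP/(_ i); rewrite ffunE eqxx; case: (s i). Qed.

Lemma transition_mean (R : realType) (n : nat) (j : couplings R n)
    (s : state n) (f : state n -> R) :
  \sum_s' transition j s s' * f s' =
  f s + \sum_(i < n) flip_prob j s i * (f (flip i s) - f s).
Proof.
rewrite (bigD1 s)//= /transition eqxx mulrBl mul1r.
under eq_bigr => s' ss' do rewrite (negbTE ss') mulr_suml.
have -> : \sum_(s' | s' != s) \sum_(i < n | flip i s == s') flip_prob j s i * f s' =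
    \sum_(i < n) flip_prob j s i * f (flip i s).
  rewrite [RHS](partition_big (fun i => flip i s) (fun s' => s' != s)) /=.
    by apply: eq_bigr => s' _; apply: eq_bigr => i /eqP ->.
  by move=> i _; exact: flip_neq.
under [X in _ = f s + X]eq_bigr do rewrite mulrBr.
by rewrite sumrB mulr_suml addrA addrAC.
Qed.

Section good_edge_dynamics.
Context (R : realType) (n : nat) (y : R) (j : couplings R n) (e : edge n).
Hypothesis ge : good_edge y j e.

Let a := (val e).1.
Let b := (val e).2.

Let ia : incident a e. Proof. by rewrite /incident eqxx. Qed.
Let ib : incident b e. Proof. by rewrite /incident eqxx orbT. Qed.
Let ab : a != b. Proof. exact: edge_neq. Qed.

Lemma flip_prob_good_edge (s : state n) (i : 'I_n) : incident i e ->
  flip_prob j s i = if s a == s b then 0 else n%:R^-1.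
Proof.
move=> ie; have := good_edge_field s ge ie; rewrite -/a -/b /flip_prob.
case: ifP => _ H; first by rewrite ltNge (ltW H) gt_eqF// mulr0 addr0 mulr0.
by rewrite H lt_eqF// mulr0 addr0 mulr1.
Qed.

Lemma transition_mean_good_edge (s : state n) (phi : bool -> bool -> R) :
  \sum_s' transition j s s' * phi (s' a) (s' b) = phi (s a) (s b) +
  (if s a == s b then 0 else n%:R^-1) *
  (phi (~~ s a) (s b) + phi (s a) (~~ s b) - 2 * phi (s a) (s b)).
Proof.
rewrite (transition_mean j s (fun s => phi (s a) (s b))); congr (_ + _).
rewrite (bigD1 a)//= (bigD1 b) /=; last by rewrite eq_sym.
rewrite big1 => [|i /andP[ia' ib']].
  rewrite !flip_prob_good_edge// !ffunE !eqxx (eq_sym b) (negbTE ab).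
  by rewrite addr0 -mulrDr addrACA -opprD -mulr2n mulr_natl.
by rewrite !ffunE !(eq_sym _ i) (negbTE ia') (negbTE ib') subrr mulr0.
Qed.

(** Flipping one of two aligned endpoints would raise the energy, and the other
    flips keep them aligned. *)
Lemma transition_aligned (c : bool) (s s' : state n) :
  (s a == c) && (s b == c) -> ~~ ((s' a == c) && (s' b == c)) ->
  transition j s s' = 0.
Proof.
move=> /andP[/eqP sa /eqP sb] ns'; rewrite /transition.
case: eqP => [E|_]; first by move: ns'; rewrite E sa sb !eqxx.
apply: big1 => i /eqP E.
have [ie|] := boolP (incident i e).
  by rewrite flip_prob_good_edge// sa sb eqxx.
rewrite negb_or => /andP[nia nib]; move: ns'.
by rewrite -E !ffunE !(eq_sym _ i) (negbTE nia) (negbTE nib) sa sb eqxx.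
Qed.

Variables (s0 : state n) (Z : zero_temp_dynamics j s0).

Let Q := dyn_law Z.
Let X := dyn_path Z.
Let chainX : markov_chain Q (transition j) s0 X := dyn_markov Z.
Let f (s : state n) : R := spin R s a + spin R s b.
Let g (s : state n) : R := (s a != s b)%:R.

(** The sum of the two spins only moves when the endpoints disagree, and then it
    goes up or down by 2 with the same probability [1 / n]. *)
Lemma good_edge_martingale t : chain_mean Q X t f = f s0.
Proof.
elim: t => [|t IH]; first exact: chain_mean0 chainX _.
rewrite (chain_meanS chainX) -[RHS]IH; apply: eq_bigr => s _; congr (_ * _).
rewrite (transition_mean_good_edge s
  (fun p q : bool => (if p then 1 else -1) + (if q then 1 else -1))).
by rewrite /f /spin; case: (s a); case: (s b) => /=; ring.
Qed.

(** Disagreeing endpoints become aligned as soon as one of them is selected. *)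
Lemma good_edge_misaligned t :
  chain_mean Q X t g = (1 - 2 / n%:R) ^+ t * g s0.
Proof.
elim: t => [|t IH]; first by rewrite mul1r; exact: chain_mean0 chainX _.
rewrite (chain_meanS chainX) exprS -mulrA -IH /chain_mean mulr_sumr.
apply: eq_bigr => s _; rewrite mulrCA; congr (_ * _).
rewrite (transition_mean_good_edge s (fun p q : bool => (p != q)%:R)).
by rewrite /g; case: (s a); case: (s b) => /=; ring.
Qed.

Lemma good_edge_misaligned_cvg : chain_mean Q X t g @[t --> \oo] --> (0 : R).
Proof.
have -> : (fun t => chain_mean Q X t g) =
    (fun t => (1 - 2 / n%:R) ^+ t * g s0).
  by apply/funext => t; exact: good_edge_misaligned.
suff : (1 - 2 / n%:R) ^+ t * g s0 @[t --> \oo] --> 0 * g s0 by rewrite mul0r.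
apply: cvgMl; apply: cvg_expr.
have n_gt1 : (1 < n)%N.
  have := valP e; rewrite /= => h.
  by apply: leq_ltn_trans (ltn_ord (val e).2); exact: leq_ltn_trans h.
have n0 : 0 < n%:R :> R by rewrite ltr0n (ltn_trans _ n_gt1).
have n2 : 2 / n%:R <= 1 :> R by rewrite ler_pdivrMr// mul1r ler_nat.
by rewrite ger0_norm ?subr_ge0// gtrBl divr_gt0.
Qed.

(** Conservation of the mean of [spin a + spin b] and the decay of the
    misalignment leave, in the limit, aligned endpoints with that mean. *)
Lemma mean_spin_good_edge : mean_spin_infty a Z = f s0 / 2.
Proof.
rewrite mean_spin_inftyE -/X -/Q.
pose B (c : bool) := fun s : state n => (s a == c) && (s b == c).
have evB (c : bool) (E : pred (state n)) : (forall s, B c s -> E s) ->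
    (1 + (if c then 1 else -1) * (f s0 / 2)) / 2 <= prob Q (eventually_in X E).
  move=> BE; apply: (@le_trans _ _ (prob Q (eventually_in X (B c)))); last first.
    apply: le_prob.
    - exact: measurable_eventually_in chainX _.
    - exact: measurable_eventually_in chainX _.
    - by move=> w [t h]; exists t => k tk; apply: BE; exact: h.
  have lim : (1 - chain_mean Q X t g + (if c then 1 else -1) * (f s0 / 2)) / 2
      @[t --> \oo] -->
      ((1 - 0 + (if c then 1 else -1) * (f s0 / 2)) / 2 : R).
    apply: cvgMl; apply: cvgD; last exact: cvg_cst.
    by apply: cvgB; [exact: cvg_cst|exact: good_edge_misaligned_cvg].
  rewrite subr0 in lim; rewrite -(cvg_lim (@Rhausdorff R) lim).
  apply: limr_le; first by apply/cvg_ex; eexists; exact: lim.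
  apply: nearW => t; rewrite -(good_edge_martingale t).
  apply: le_trans (absorbing_le chainX t (@transition_aligned c)).
  rewrite -(chain_mean_indicator chainX t (B c)).
  rewrite -[X in X - _](chain_mean1 chainX t) /chain_mean.
  rewrite mulr_suml mulr_sumr -sumrB -big_split mulr_suml.
  apply: ler_sum => s _; rewrite le_eqVlt; apply/orP; left; apply/eqP.
  by rewrite /B /f /g /spin; case: (c); case: (s a); case: (s b) => /=; field.
have /evB P : forall s, B true s -> s a by move=> s /andP[/eqP].
have /evB N : forall s, B false s -> ~~ s a by move=> s /andP[/eqP ->].
set A := prob _ _ in P *; set C := prob _ _ in N *.
(* The two lower bounds add up to 1, so that both are equalities. *)
have AC : A + C <= 1.
  rewrite /A /C -probU.
  - apply: prob_le1; apply: measurableU; exact: measurable_eventually_in chainX _.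
  - exact: measurable_eventually_in chainX _.
  - exact: measurable_eventually_in chainX _.
  - apply/seteqP; split => // w [[t At] [t' Bt]].
    by have := Bt (maxn t t') (leq_maxr _ _); rewrite At// leq_maxl.
move: P N AC; set F := f s0; lra.
Qed.

End good_edge_dynamics.

(** * Overlap of the limiting spins *)

(** The integral of a nonnegative function is the supremum of the integrals of the
    simple functions below it, hence monotone even for functions which are not
    known to be measurable, such as the overlap as a function of the couplings. *)
Lemma expectation_monotone (R : realType) (d : measure_display)
    (T : measurableType d) (P : probability T R) (f g : T -> R) :
  (forall w, 0 <= f w) -> (forall w, f w <= g w) -> ('E_P[f] <= 'E_P[g])%E.
Proof.
move=> f0 fg; have g0 w : 0 <= g w by exact: le_trans (fg w).
rewrite unlock !ge0_integralTE; try by move=> w; rewrite lee_fin.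
apply: le_ereal_sup => _ [h hf <-]; exists h => // w.
by apply: (le_trans (hf w)); rewrite lee_fin.
Qed.

Lemma mean_spin_sqr_le1 (R : realType) (n : nat) (j : couplings R n)
    (s0 : state n) (Z : zero_temp_dynamics j s0) (i : 'I_n) :
  mean_spin_infty i Z ^+ 2 <= 1.
Proof.
rewrite mean_spin_inftyE.
set A := eventually_in _ _; set B := eventually_in _ _.
have mA : measurable A by exact: measurable_eventually_in (dyn_markov Z) _.
have mB : measurable B by exact: measurable_eventually_in (dyn_markov Z) _.
have := prob_le1 (dyn_law Z) mA; have := prob_le1 (dyn_law Z) mB.
have := prob_ge0 (dyn_law Z) A; have := prob_ge0 (dyn_law Z) B.
by nra.
Qed.

Section overlap.
Context (R : realType) (d : measure_display) (T : measurableType d)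
  (P : probability T R) (n : nat) (J : edge n.+1 -> {RV P >-> R})
  (s0 : T -> state n.+1).
Hypotheses (unif : uniform_state P s0) (indep : independent_of_couplings J s0).

Lemma generated_good_edge (y : R) (e : edge n.+1) :
  <<s [set J e @^-1` B | e in [set: edge n.+1] & B in measurable] >>
    [set w | good_edge y (fun e => J e w) e].
Proof.
set G := [set J e @^-1` B | e in [set: edge n.+1] & B in measurable].
pose X f : g_sigma_algebraType G -> R := J f.
have mX f : measurable_fun setT (X f).
  by move=> _ B mB; rewrite setTI; apply: sub_sigma_algebra; exists f => //; exists B.
exact: (measurable_good_edge mX).
Qed.

(** Flipping the spin at [a] exchanges agreement and disagreement with [b], so
    either relation holds for half of the initial states. *)
Lemma prob_good_initial (y : R) (e : edge n.+1) (a b : 'I_n.+1) (c : bool) :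
  a != b ->
  prob P ([set w | good_edge y (fun e => J e w) e] `&`
    [set w | (s0 w a == s0 w b) == c]) =
  prob P [set w | good_edge y (fun e => J e w) e] / 2.
Proof.
move=> ab; set A := [set w | _].
have mA : measurable A by apply: measurable_good_edge => f; exact: measurable_funP.
have ms s : measurable [set w | s0 w = s] := (unif s).1.
pose q (c : bool) := \sum_(s : state n.+1) ((s a == s b) == c)%:R : R.
have E (c' : bool) : prob P (A `&` [set w | (s0 w a == s0 w b) == c']) =
    prob P A * (2 ^+ n.+1)^-1 * q c'.
  have mc : measurable [set w | (s0 w a == s0 w b) == c'].
    exact: (@measurable_fin_fun_in _ T _ s0 (fun s => (s a == s b) == c') ms).
  rewrite (prob_partition P (measurableI _ _ mA mc) ms) /q mulr_sumr.
  apply: eq_bigr => s _.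
  have [sc|sc] := boolP ((s a == s b) == c'); last first.
    rewrite mulr0 (_ : _ `&` _ = set0) ?/prob ?measure0//.
    by apply/seteqP; split => // w [[_ /= h] ws]; move: sc; rewrite -ws h.
  rewrite mulr1 (_ : _ `&` _ = A `&` [set w | s0 w = s]); last first.
    apply/seteqP; split => w /=; first by move=> [[]].
    by move=> [Aw ws]; split => //; split => //; rewrite ws.
  rewrite /prob indep; last exact: generated_good_edge.
  by rewrite (unif s).2 fineM// fin_num_measure.
have qN c' : q (~~ c') = q c'.
  rewrite /q (reindex_inj (h := flip a)) /=.
    apply: eq_bigr => s _; rewrite !ffunE eqxx (eq_sym b) (negbTE ab).
    by case: (s a); case: (s b); case: c'.
  apply: (can_inj (g := flip a)) => s; apply/ffunP => i; rewrite !ffunE.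
  by case: eqP => // _; rewrite negbK.
have q2 : q c + q c = 2 ^+ n.+1.
  rewrite -{2}(qN c) /q -big_split /= (eq_bigr (fun=> 1)); last first.
    by move=> s _; case: (s a == s b); case: (c); rewrite /= ?addr0 ?add0r.
  rewrite sumr_const card_ffun card_bool card_ord natrX.
  by [].
rewrite E -mulrA; congr (_ * _).
rewrite -q2 -mulr2n -mulr_natl.
have q0 : q c != 0.
  by apply: contra_eq_neq q2 => ->; rewrite addr0 eq_sym expf_neq0.
by field.
Qed.

Variable (Z : forall (j : couplings R n.+1) (s : state n.+1),
  zero_temp_dynamics j s).

Definition edge0 (k : 'I_n) : edge n.+1 :=
  Sub (ord0 : 'I_n.+1, lift ord0 k) isT.

Let good (y : R) k := [set w | good_edge y (fun e => J e w) (edge0 k)].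
Let initial (k : 'I_n) c := [set w | (s0 w ord0 == s0 w (lift ord0 k)) == c].

Lemma edge0_inj : injective edge0.
Proof. by move=> k l /(congr1 val) [] /eqP; rewrite eqn_add2l => /eqP /val_inj. Qed.

(** The events that [edge0 k] is good are disjoint, as all these edges meet at
    the first site. *)
Lemma prob_good_union (y : R) (c : bool) :
  prob P (\big[setU/set0]_(k < n) (good y k `&` initial k c)) =
  (\sum_k prob P (good y k)) / 2.
Proof.
have mg k : measurable (good y k `&` initial k c).
  apply: measurableI.
    by apply: measurable_good_edge => f; exact: measurable_funP.
  apply: (@measurable_fin_fun_in _ T _ s0 (fun s => (s ord0 == s (lift ord0 k)) == c)).
  by move=> s; exact: (unif s).1.
rewrite mulr_suml; under [RHS]eq_bigr => k _.
  rewrite -(@prob_good_initial y (edge0 k) ord0 (lift ord0 k) c); last first.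
    exact: neq_lift.
  over.
rewrite /prob measure_bigsetU_ord//.
  by rewrite sum_fine// => k _; apply: fin_num_measure; exact: mg.
move=> k l _ _ [w [[gk _] [gl _]]]; apply: edge0_inj.
by apply: (good_edge_disjoint gk gl (i := ord0)); rewrite /incident eqxx.
Qed.


End overlap.

(** The overlap is at least the probability that some edge at the first site is
    good with aligned endpoints at time 0, where the squared mean is 1, and it
    falls short of 1 by at least the probability of the same event with opposite
    endpoints, where the squared mean is 0. *)
Lemma qD_bounds (R : realType) (d : measure_display) (T : measurableType d)
    (P : probability T R) (n : nat) (J : edge n.+1 -> {RV P >-> R})
    (s0 : T -> state n.+1)
    (Z : forall (j : couplings R n.+1) (s : state n.+1), zero_temp_dynamics j s)
    (y : R) :
  uniform_state P s0 -> independent_of_couplings J s0 ->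
  let a := (\sum_(k < n)
    prob P [set w | good_edge y (fun e => J e w) (edge0 k)]) / 2 in
  (a%:E <= qD J s0 Z)%E /\ (qD J s0 Z <= (1 - a)%:E)%E.
Proof.
move=> unif indep a.
pose U c := \big[setU/set0]_(k < n)
  ([set w | good_edge y (fun e => J e w) (edge0 k)] `&`
   [set w | (s0 w ord0 == s0 w (lift ord0 k)) == c]).
have mU c : measurable (U c).
  apply: bigsetU_measurable => k _; apply: measurableI.
    by apply: measurable_good_edge => f; exact: measurable_funP.
  apply: (@measurable_fin_fun_in _ T _ s0 (fun s => (s ord0 == s (lift ord0 k)) == c)).
  by move=> s; exact: (unif s).1.
have UE c : prob P (U c) = a by exact: prob_good_union.
pose f w := mean_spin_infty ord0 (Z (fun e => J e w) (s0 w)) ^+ 2.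
have f0 w : 0 <= f w by exact: sqr_ge0.
have fU c w : U c w -> f w = c%:R.
  rewrite /U -bigcup_seq => -[k _ [/= gk /eqP <-]].
  have := mean_spin_good_edge gk (Z (fun e => J e w) (s0 w)).
  rewrite /f /= => ->; rewrite /spin.
  by case: (s0 w ord0); case: (s0 w (lift ord0 k)) => /=; field.
have -> : qD J s0 Z = ('E_P[f])%E by [].
split.
  rewrite -(UE true) -probE// -expectation_indic//; apply: expectation_monotone => w //.
  rewrite indicE; have [Uw|nU] := pselect (U true w).
    by rewrite (fU true)// mem_set.
  by rewrite memNset.
rewrite -(UE false) -prob_setC// -probE; last exact: measurableC.
rewrite -expectation_indic; last exact: measurableC.
apply: expectation_monotone => // w; rewrite indicE.
have [Uw|nU] := pselect (U false w); first by rewrite (fU false).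
by rewrite mem_set//; exact: mean_spin_sqr_le1.
Qed.

(** * Local minima and non-trivial overlap *)

Theorem theorem2 (R : realType) (alpha : R) (halpha0 : 0 < alpha)
  (halpha1 : alpha < 1)
  (L : R -> R) (hL : slowly_varying L)
  (mu : probability (measurableTypeR R) R)
  (mu_ge0 : mu [set x : R | x < 0] = 0%E)
  (mu_tail : forall x : R, 0 < x ->
     mu [set y : R | x <= y] = (x `^ (- alpha) * L x)%:E)
  (d : nat -> measure_display) (T : forall n : nat, measurableType (d n))
  (P : forall n : nat, probability (T n) R)
  (J : forall n : nat, edge n.+1 -> {RV (P n) >-> R})
  (hJ : forall n : nat, iid (J n) mu) :
  (P n [set w | exists s : state n.+1,
          local_minimum (fun e => J n e w) s] @[n --> \oo] --> 1%E) /\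
  (exists eps : R, 0 < eps /\
     forall (s0 : forall n : nat, T n -> state n.+1)
       (Z : forall (n : nat) (j : couplings R n.+1) (s : state n.+1),
          zero_temp_dynamics j s),
       (forall n : nat, uniform_state (P n) (s0 n)) ->
       (forall n : nat, independent_of_couplings (J n) (s0 n)) ->
       \forall n \near \oo,
         (eps%:E < qD (J n) (s0 n) (Z n))%E /\
         (qD (J n) (s0 n) (Z n) < (1 - eps)%:E)%E).
Proof.
have [C [k0 [C0 hk]]] := cap_mean_tail halpha1 hL mu_tail mu_ge0.
have [tk0 _ _] := hk k0 (leqnn _).
have level t : 0 < t -> t < tail mu (2 ^+ k0) -> exists k : nat,
    [/\ t / 2 <= tail mu (2 ^+ k), tail mu (2 ^+ k) <= t &
      (cap_mean mu (2 ^+ k) <= (C * (2 ^+ k * tail mu (2 ^+ k)))%:E)%E].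
  move=> t0 tlt.
  have half k : (k0 <= k)%N -> tail mu (2 ^+ k) <= 2 * tail mu (2 ^+ k.+1).
    by move=> /hk[].
  have [k [k0k h1 h2]] := tail_level half t0 tlt.
  by exists k; split => //; have [] := hk k k0k.
have pow2 k : 0 < 2 ^+ k :> R by rewrite exprn_gt0.
split.
  pose LM n := [set w | exists s : state n.+1, local_minimum (fun e => J n e w) s].
  have mLM n : measurable (LM n).
    by apply: measurable_local_minimum => e; exact: measurable_funP.
  rewrite (_ : (fun n => _) = (fun n => (prob (P n) (LM n))%:E)); last first.
    by apply/funext => n; rewrite -probE.
  apply: cvg_EFin; first exact: nearW.
  apply/cvgrPdist_le => eps eps0.
  (* Makes [2 / (1 + K / 8)] at most [eps / 2]. *)
  pose K := 32 / eps.
  have K0 : 0 < K by rewrite divr_gt0.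
  near=> n.
  have n2 : (2 < n)%N by near: n; exact: nbhs_infty_gt.
  have nK : 16 * C * K ^+ 2 / eps <= n%:R by near: n; exact: nbhs_infty_ger.
  have nt : K / tail mu (2 ^+ k0) < n%:R by near: n; exact: nbhs_infty_gtr.
  have n0 : 0 < n%:R :> R by rewrite ltr0n; lia.
  have n20 : 0 < n%:R ^+ 2 :> R by rewrite exprn_gt0.
  have tlt : K / n%:R ^+ 2 < tail mu (2 ^+ k0).
    apply: (@le_lt_trans _ _ (K / n%:R)).
      rewrite ler_pM2l// lef_pV2 ?posrE// expr2 ler_peMl ?ler1n ?ltW//; lia.
    by rewrite ltr_pdivrMr// mulrC -ltr_pdivrMr.
  have [k [p1 p2 hC]] := level _ (divr_gt0 K0 n20) tlt.
  have [s1 [s2 [dis c1 c2]]] := exists_half_sets (edge n.+1).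
  have := prob_no_local_minimum (hJ n) (pow2 k) C0 hC dis.
  rewrite prob_setC// card_edge in c1 c2 *.
  rewrite ger0_norm ?subr_ge0 ?prob_le1// => /le_trans; apply.
  apply: (le_trans (no_local_minimum_bound C0 K0 n2 c1 c2 p1 p2)).
  have b1 : 2 / (1 + K / 8) <= eps / 2.
    rewrite ler_pdivrMr; last by rewrite ltr_pwDl// divr_ge0// ltW.
    rewrite /K mulrDr mulr1 (_ : eps / 2 * _ = 2); last by field; rewrite gt_eqF.
    by rewrite lerDr ltW// divr_gt0.
  have b2 : 8 * C * K ^+ 2 / n%:R <= eps / 2.
    rewrite ler_pdivrMr//; move: nK; rewrite ler_pdivrMr//; lra.
  lra.
(* With tails at most [c / n], at most half of the large edges are expected not
   to be good. *)
pose c : R := (16 * C)^-1.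
have c0 : 0 < c by rewrite invr_gt0 mulr_gt0.
exists (c / 16); split; first by rewrite divr_gt0.
move=> s0 Z unif indep; near=> n.
have n0' : (0 < n)%N by near: n; exact: nbhs_infty_gt.
have nt : c / tail mu (2 ^+ k0) < n%:R by near: n; exact: nbhs_infty_gtr.
have n0 : 0 < n%:R :> R by rewrite ltr0n.
have tlt : c / n%:R < tail mu (2 ^+ k0).
  by rewrite ltr_pdivrMr// mulrC -ltr_pdivrMr.
have [k [p1 p2 hC]] := level _ (divr_gt0 c0 n0) tlt.
have good_ge e : c / n%:R / 4 <=
    prob (P n) [set w | good_edge (2 ^+ k) (fun e => J n e w) e].
  apply: le_trans (prob_good_ge (hJ n) (pow2 k) C0 hC e).
  set p := tail mu _ in p1 p2 *.
  have p0 : 0 < p by apply: lt_le_trans p1; rewrite !divr_gt0.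
  apply: (@le_trans _ _ (p / 2)); first by lra.
  suff : (4 * n.+1)%:R * (C * p ^+ 2) <= p / 2 by lra.
  apply: (@le_trans _ _ (8 * n%:R * (C * (p * (c / n%:R))))).
    apply: ler_pM => //; first by rewrite mulr_ge0 ?sqr_ge0 ?ltW.
      by rewrite -natrM ler_nat; lia.
    by rewrite ler_pM2l// expr2 ler_pM2l.
  rewrite le_eqVlt; apply/orP; left; apply/eqP; rewrite /c; field.
  by rewrite !gt_eqF.
have [lower upper] := qD_bounds (Z n) (2 ^+ k) (unif n) (indep n).
have sum_ge : c / 4 <= \sum_(i < n)
    prob (P n) [set w | good_edge (2 ^+ k) (fun e => J n e w) (edge0 i)].
  apply: le_trans (ler_sum _ (fun i _ => good_ge (edge0 i))).
  rewrite sumr_const card_ord -mulr_natl le_eqVlt; apply/orP; left; apply/eqP.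
  by field; rewrite gt_eqF.
split; [apply: lt_le_trans lower|apply: (le_lt_trans upper)]; rewrite lte_fin; lra.
Unshelve. all: by end_near.
Qed.
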